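(* For every $n\geq 1$, $$\sum_{\sigma\in\tilde{\mathfrak S}_{n+1}} t^{d_3(\sigma)}q^{i_3(\sigma)}=\sum_{\omega\in\mathfrak S_n} t^{\hat d(\omega)}q^{\hat\imath(\omega)}.$$
   Context: $\mathfrak S_n$ is the set of permutations $\sigma=\sigma_1\cdots\sigma_n$ of $[n]$, and $\tilde{\mathfrak S}_{n}$ the set of $\sigma\in\mathfrak S_n$ with $\sigma_1=1$. For $\sigma\in\mathfrak S_m$: a $3$-descent is a position $i\in[m-2]$ such that $\sigma_i\sigma_{i+1}\sigma_{i+2}$ (standardized) is an odd permutation in $\mathfrak S_3$; $d_3(\sigma)$ is the number of $3$-descents. For $i\in[m-2]$, $c^3_i(\sigma)$ is the number of indices $j>i+1$ such that $\sigma_i\sigma_{i+1}\sigma_j$ (standardized) is an odd permutation of size $3$, and $i_3(\sigma)=\sum_{i=1}^{m-2}c^3_i(\sigma)$. For $\omega\in\mathfrak S_n$: an alternating descent is a position $i\in[n-1]$ with either $i$ odd and $\omega_i>\omega_{i+1}$, or $i$ even and $\omega_i<\omega_{i+1}$; $\hat d(\omega)$ is their number. For $i\in[n-1]$, $\hat c_i(\omega)$ is the number of $j>i$ with $\omega_i>\omega_j$ if $i$ is odd, and the number of $j>i$ with $\omega_i<\omega_j$ if $i$ is even; $\hat\imath(\omega)=\sum_{i=1}^{n-1}\hat c_i(\omega)$. *)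

(* Defs.v *)
From HB Require Import structures.
From mathcomp Require Import all_boot all_order all_algebra all_fingroup.

Set Implicit Arguments.
Unset Strict Implicit.
Unset Printing Implicit Defensive.

Import GRing.Theory.

(* MathComp's 'S_m permutes 'I_m = {0, .., m.-1}; [letter s i] is the i-th
   letter of the word s_1 ... s_m of s as a permutation of {1, .., m}: both
   positions and values are counted from 1, so that the parity of a position
   is the usual one.  It is 0 for i > m; position 0 is never used. *)
Definition oneline (m : nat) (s : 'S_m) : seq nat :=
  [seq (s k).+1 | k <- enum 'I_m].

Definition letter (m : nat) (s : 'S_m) (i : nat) : nat :=
  nth 0 (oneline s) i.-1.

(* Standardization of a word of k distinct integers: the unique permutation
   in 'S_k whose letters are in the same relative order (see [ltn_std] and
   [std_unique]).  The default value is used only for words with repetitions. *)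
Definition std (k : nat) (w : k.-tuple nat) : 'S_k :=
  odflt 1%g [pick s : 'S_k |
    [forall i, forall j, (s i < s j) == (tnth w i < tnth w j)]].

Lemma std_exists (k : nat) (w : k.-tuple nat) : uniq w ->
  exists s : 'S_k, forall i j, (s i < s j) = (tnth w i < tnth w j).
Proof.
move=> /tuple_uniqP w_inj.
pose below i := [set j | tnth w j < tnth w i].
have below_lt i : #|below i| < k.
  rewrite -[X in _ < X]card_ord -cardsT proper_card // properT.
  by apply/eqP => /setP/(_ i); rewrite !inE ltnn.
have below_mono i j : tnth w i < tnth w j -> #|below i| < #|below j|.
  move=> wij; apply: proper_card; apply/properP; split.
    by apply/subsetP => l; rewrite !inE => /ltn_trans; apply.
  by exists i; rewrite !inE ?ltnn.
have below_ltE i j : (#|below i| < #|below j|) = (tnth w i < tnth w j).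
  apply/idP/idP => [|/below_mono//].
  case: (ltngtP (tnth w i) (tnth w j)) => // [/below_mono/ltnW|/w_inj->].
    by rewrite leqNgt => /negbTE ->.
  by rewrite ltnn.
pose rk i : 'I_k := Ordinal (below_lt i).
have rk_inj : injective rk.
  move=> i j /(congr1 val) /= eq_ij; apply: w_inj; apply/eqP.
  by case: (ltngtP (tnth w i) (tnth w j)) => // /below_mono; rewrite eq_ij ltnn.
by exists (perm rk_inj) => i j; rewrite !permE /= below_ltE.
Qed.

Lemma ltn_std (k : nat) (w : k.-tuple nat) (i j : 'I_k) : uniq w ->
  (std w i < std w j) = (tnth w i < tnth w j).
Proof.
move=> /std_exists[s sE]; rewrite /std; case: pickP => [u|/(_ s)].
  by move=> /forallP/(_ i)/forallP/(_ j)/eqP.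
by move/forallP; case; move=> a; apply/forallP => b; rewrite sE.
Qed.

Lemma std_unique (k : nat) (w : k.-tuple nat) (s : 'S_k) : uniq w ->
  (forall i j, (s i < s j) = (tnth w i < tnth w j)) -> s = std w.
Proof.
move=> w_uniq sE; have stdE i j := ltn_std i j w_uniq.
have cnt (u : 'S_k) i : #|[set j | u j < u i]| = u i.
  rewrite -(card_imset _ (@perm_inj _ u)).
  have -> : u @: [set j | u j < u i] = [set l : 'I_k | l < u i].
    apply/setP => l; rewrite inE; apply/imsetP/idP => [[j]|li].
      by rewrite inE => ? ->.
    by exists (u^-1%g l); rewrite ?inE permKV.
  rewrite cardE -(size_map val) -[RHS](size_iota 0); apply: perm_size.
  apply: uniq_perm; rewrite ?iota_uniq ?(map_inj_uniq val_inj) ?enum_uniq //.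
  move=> x; rewrite mem_iota add0n /=; apply/mapP/idP => [[l]|xi].
    by rewrite mem_enum inE => ? ->.
  have xk : x < k by apply: ltn_trans xi (ltn_ord _).
  by exists (Ordinal xk); rewrite ?mem_enum ?inE.
apply/permP => i; apply: val_inj; rewrite /= -(cnt s i) -(cnt (std w) i).
by apply: eq_card => j; rewrite !inE sE stdE.
Qed.

Definition odd3 (a b c : nat) : bool := odd_perm (std [tuple a; b; c]).

Definition is_3descent (m : nat) (s : 'S_m) (i : nat) : bool :=
  odd3 (letter s i) (letter s i.+1) (letter s i.+2).

(* i ranges over {1, .., m-2}. *)
Definition d3 (m : nat) (s : 'S_m) : nat :=
  \sum_(1 <= i < m.-1 | is_3descent s i) 1.

Definition c3 (m : nat) (s : 'S_m) (i : nat) : nat :=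
  \sum_(i.+2 <= j < m.+1 | odd3 (letter s i) (letter s i.+1) (letter s j)) 1.

Definition i3 (m : nat) (s : 'S_m) : nat := \sum_(1 <= i < m.-1) c3 s i.

Definition alt_inverted (i a b : nat) : bool := if odd i then a > b else a < b.

Definition is_altdescent (n : nat) (w : 'S_n) (i : nat) : bool :=
  alt_inverted i (letter w i) (letter w i.+1).

Definition dhat (n : nat) (w : 'S_n) : nat :=
  \sum_(1 <= i < n | is_altdescent w i) 1.

Definition chat (n : nat) (w : 'S_n) (i : nat) : nat :=
  \sum_(i.+1 <= j < n.+1 | alt_inverted i (letter w i) (letter w j)) 1.

Definition ihat (n : nat) (w : 'S_n) : nat := \sum_(1 <= i < n) chat w i.

Definition tildeS (n : nat) : {set 'S_n} := [set s : 'S_n | letter s 1 == 1].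

(* The two independent indeterminates of Z[q][t]. *)
Definition tvar : {poly {poly int}} := 'X%R.
Definition qvar : {poly {poly int}} := ('X%:P)%R.

(* Main.v *)
(** For both families the code ([chat], resp. [c3]) is a bijection onto the
    sequences (c_1, .., c_n) with 0 <= c_i <= n - i, and position i is a descent
    if and only if c_i + c_(i+1) >= n - i; hence both pairs of statistics are
    the same function of the code.  For [c3], note that abc is odd exactly when
    c lies on the arc from a to b for the cyclic order of the letters, so that
    c3_i is the rank of the letter i+1 among the letters not yet used, counted
    cyclically from the letter i.  The descent criterion holds because the two
    sets of letters counted by c_i and c_(i+1) cover all letters after position
    i when i is a descent, and are disjoint otherwise. *)
Require Import Defs.
From mathcomp Require Import all_boot all_order all_algebra all_fingroup.
From mathcomp Require Import zify.

Set Implicit Arguments.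
Unset Strict Implicit.
Unset Printing Implicit Defensive.

(** * Letters of a word, and odd patterns as arcs of the cyclic order *)

Lemma letterE (m : nat) (s : 'S_m) (k : 'I_m) : letter s k.+1 = (s k).+1.
Proof.
rewrite /letter /oneline /= (nth_map k) ?nth_ord_enum //.
by rewrite size_enum_ord.
Qed.

Lemma letter_inj (m : nat) (s : 'S_m) (i j : nat) :
  0 < i <= m -> 0 < j <= m -> letter s i = letter s j -> i = j.
Proof.
case: i j => [|i] [|j] //= im jm.
rewrite (letterE s (Ordinal im)) (letterE s (Ordinal jm)).
by case=> /val_inj/perm_inj[->].
Qed.

(** In the first disjunct the arc from [a] up to [b] does not wrap around; in the other two it does,
    with [c] after, respectively before, the wrap. *)
Definition cyc (a b c : nat) : bool := [|| a < c < b, c < b < a | b < a < c].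

Lemma ord3_forallP (P : 'I_3 -> Prop) :
  P (inord 0) -> P (inord 1) -> P (inord 2) -> forall i, P i.
Proof.
move=> P0 P1 P2 [[|[|[|//]]] lt_i3].
- by have -> : Ordinal lt_i3 = inord 0 by apply: val_inj; rewrite /= inordK.
- by have -> : Ordinal lt_i3 = inord 1 by apply: val_inj; rewrite /= inordK.
- by have -> : Ordinal lt_i3 = inord 2 by apply: val_inj; rewrite /= inordK.
Qed.

Lemma odd3E (a b c : nat) : uniq [:: a; b; c] -> odd3 a b c = cyc a b c.
Proof.
move=> w_uniq; rewrite /odd3.
set w := [tuple a; b; c]; pose o k : 'I_3 := inord k.
have stdE (s : 'S_3) :
    (forall i j, (s i < s j) = (tnth w i < tnth w j)) -> std w = s.
  by move=> sE; rewrite (@std_unique _ w s).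
have w0 : tnth w (o 0) = a by rewrite (tnth_nth 0) inordK.
have w1 : tnth w (o 1) = b by rewrite (tnth_nth 0) inordK.
have w2 : tnth w (o 2) = c by rewrite (tnth_nth 0) inordK.
have o01 : (o 0 == o 1) = false by rewrite -val_eqE /= !inordK.
have o02 : (o 0 == o 2) = false by rewrite -val_eqE /= !inordK.
have o12 : (o 1 == o 2) = false by rewrite -val_eqE /= !inordK.
have o10 : (o 1 == o 0) = false by rewrite eq_sym.
have o20 : (o 2 == o 0) = false by rewrite eq_sym.
have o21 : (o 2 == o 1) = false by rewrite eq_sym.
have oE := (o01, o02, o12, o10, o20, o21).
(* Three comparisons of letters already determine the standardization. *)
have check (s : 'S_3) : s (o 0) < s (o 1) = (a < b) ->
    s (o 0) < s (o 2) = (a < c) -> s (o 1) < s (o 2) = (b < c) -> std w = s.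
  move=> s01 s02 s12; apply: stdE.
  have neq i j : (i == j) = false -> (s i : nat) != s j.
    by move=> ij; rewrite val_eqE (inj_eq perm_inj) ij.
  have := (neq _ _ o01, neq _ _ o02, neq _ _ o12).
  move: w_uniq; rewrite /= !inE => w_uniq [[n01 n02] n12].
  by apply: ord3_forallP; apply: ord3_forallP;
    rewrite -?/(o _) ?w0 ?w1 ?w2; lia.
rewrite /cyc; move: w_uniq; rewrite /= !inE.
have valo k : k < 3 -> val (o k) = k by move=> ?; rewrite /= inordK.
case: (ltngtP a b) => //= ab; case: (ltngtP a c) => //= ac;
  case: (ltngtP b c) => //= bc _; try lia.
(* The order types are 123, 132, 231, 213, 312, 321 in turn; the two 3-cycles are written as
   products of transpositions so that their parity computes. *)
- rewrite (@check 1%g) ?odd_perm1 ?perm1 ?valo //; lia.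
- rewrite (@check (tperm (o 1) (o 2))) ?odd_tperm ?oE ?permE /= ?oE ?eqxx ?valo //; lia.
- rewrite (@check (tperm (o 0%N) (o 1%N) * tperm (o 0%N) (o 2%N))%g);
  rewrite ?odd_permM ?odd_tperm ?permM ?permE /= ?oE ?eqxx ?permE /= ?oE ?eqxx ?valo //; lia.
- rewrite (@check (tperm (o 0) (o 1))) ?odd_tperm ?oE ?permE /= ?oE ?eqxx ?valo //; lia.
- rewrite (@check (tperm (o 0%N) (o 2%N) * tperm (o 0%N) (o 1%N))%g);
  rewrite ?odd_permM ?odd_tperm ?permM ?permE /= ?oE ?eqxx ?permE /= ?oE ?eqxx ?valo //; lia.
- rewrite (@check (tperm (o 0) (o 2))) ?odd_tperm ?oE ?permE /= ?oE ?eqxx ?valo //; lia.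
Qed.

Lemma odd3_letter (m : nat) (s : 'S_m) (i j k : nat) :
  0 < i -> i < j -> j < k -> k <= m ->
  odd3 (letter s i) (letter s j) (letter s k) =
  cyc (letter s i) (letter s j) (letter s k).
Proof.
move=> i0 ij jk km; apply: odd3E.
rewrite /= !inE; apply/and3P; split=> //; last first.
  by apply/eqP => /letter_inj; lia.
apply/norP; split; apply/eqP => /letter_inj; lia.
Qed.

(** For fixed [a], [cyc a y x] says that [x] comes before [y] going up cyclically from [a]: a strict
    order, total away from [a]. *)
Lemma cyc_trans (a : nat) : transitive (fun x y => cyc a y x).
Proof. by move=> y x z; rewrite /cyc; lia. Qed.

Lemma cyc_irr (a : nat) : irreflexive (fun x y => cyc a y x).
Proof. by move=> x; rewrite /cyc; lia. Qed.

Lemma cyc_total (a x y : nat) :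
  x != a -> y != a -> x != y -> cyc a y x || cyc a x y.
Proof. by rewrite /cyc; lia. Qed.

(** * A word is determined by its code *)

(** Common form of [chat] and [c3], whose order [lt] changes with the position. Here [k] counts from
    0, as in ['I_m]. *)
Definition later_below (lt : rel nat) (m : nat) (s : 'S_m) (k : nat) : nat :=
  \sum_(k.+2 <= j < m.+1 | lt (letter s j) (letter s k.+1)) 1.

Lemma later_belowE (lt : rel nat) (m : nat) (s : 'S_m) (k : 'I_m) :
  later_below lt s k = #|[set j : 'I_m | lt (s j).+1 (s k).+1 & k < j]|.
Proof.
rewrite /later_below big_add1 /= big_geq_mkord -sum1_card.
by apply: eq_bigl => j; rewrite inE !letterE.
Qed.

(** Agreement before [k] leaves both words the same letters from [k] on. By transitivity every
    letter counted for [s] is counted for [s'], and [s k] is counted for [s'] only. *)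
Lemma later_below_lt (lt : rel nat) (m : nat) (s s' : 'S_m) (k : 'I_m) :
  transitive lt -> irreflexive lt ->
  (forall j : 'I_m, j < k -> s j = s' j) ->
  lt (s k).+1 (s' k).+1 -> later_below lt s k < later_below lt s' k.
Proof.
move=> lt_trans lt_irr ss' lt_k; rewrite !later_belowE.
have future (z j j' : 'I_m) : k <= j -> s j = z -> s' j' = z -> k <= j'.
  move=> kj sj s'j'; rewrite leqNgt; apply/negP => j'k.
  move: s'j'; rewrite -ss' // -sj => /perm_inj jj'; move: kj.
  by rewrite -jj' leqNgt j'k.
(* Counting letters instead of positions turns the claim into a strict inclusion. *)
rewrite -[X in X < _](card_imset _ (@perm_inj _ s)).
rewrite -[X in _ < X](card_imset _ (@perm_inj _ s')).
have later_s' (z j : 'I_m) : k <= j -> s j = z -> lt z.+1 (s' k).+1 ->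
    z \in s' @: [set j | lt (s' j).+1 (s' k).+1 & k < j].
  move=> kj sj zk; apply/imsetP; exists (s'^-1%g z); last by rewrite permKV.
  rewrite inE permKV zk ltn_neqAle (future z j) ?permKV // andbT.
  apply/negP => /eqP/val_inj kz; move: zk.
  by rewrite [in X in lt _ X]kz permKV lt_irr.
apply: proper_card; apply/properP; split.
  apply/subsetP => z /imsetP[j]; rewrite inE => /andP[ltj kj] zE.
  apply: (later_s' z j (ltnW kj) (esym zE)); rewrite zE.
  exact: lt_trans ltj lt_k.
exists (s k); first exact: later_s' lt_k.
by apply/imsetP => -[j]; rewrite inE => /andP[_ kj] /perm_inj jk;
   rewrite jk ltnn in kj.
Qed.

(** Totality is asked only of the two letters at [k], because the cyclic order does not compare its
    base point with other letters. *)
Lemma later_below_inj (lt : rel nat) (m : nat) (s s' : 'S_m) (k : 'I_m) :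
  transitive lt -> irreflexive lt ->
  (forall j : 'I_m, j < k -> s j = s' j) ->
  ((s k).+1 != (s' k).+1 -> lt (s k).+1 (s' k).+1 || lt (s' k).+1 (s k).+1) ->
  later_below lt s k = later_below lt s' k -> s k = s' k.
Proof.
move=> ltT lt_irr ss' lt_total eq_k; apply/eqP/negPn/negP => neq_k.
have /lt_total/orP[ltk|ltk] : (s k).+1 != (s' k).+1 by rewrite eqSS.
  by have := @later_below_lt _ _ _ _ _ ltT lt_irr ss' ltk; rewrite eq_k ltnn.
have s's (j : 'I_m) : j < k -> s' j = s j by move=> /ss' ->.
by have := @later_below_lt _ _ _ _ _ ltT lt_irr s's ltk; rewrite eq_k ltnn.
Qed.

Lemma perm_eq_left_to_right (m : nat) (s s' : 'S_m) :
  (forall k : 'I_m, (forall j : 'I_m, j < k -> s j = s' j) -> s k = s' k) ->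
  s = s'.
Proof.
move=> step; apply/permP => k; move: {2}(val k) (erefl (val k)) => i.
elim/ltn_ind: i k => i IH k ki; apply: step => j jk.
by apply: (IH j) => //; rewrite -ki.
Qed.

Lemma chat_later_below (n : nat) (w : 'S_n) (k : nat) :
  chat w k.+1 = later_below (fun x y => alt_inverted k.+1 y x) w k.
Proof. by []. Qed.

Lemma chat_inj (n : nat) (w w' : 'S_n) :
  (forall i, 0 < i <= n -> chat w i = chat w' i) -> w = w'.
Proof.
move=> eq_c; apply: perm_eq_left_to_right => k ww'.
apply: (@later_below_inj (fun x y => alt_inverted k.+1 y x)) => //.
- by move=> y x z; rewrite /alt_inverted; case: ifP; lia.
- by move=> x; rewrite /alt_inverted; case: ifP; lia.
- by rewrite /alt_inverted; case: ifP; lia.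
- by rewrite -!chat_later_below; apply: eq_c; rewrite ltn_ord.
Qed.

Lemma c3_later_below (m : nat) (s : 'S_m) (k : nat) : 0 < k ->
  c3 s k = later_below (fun x y => cyc (letter s k) y x) s k.
Proof.
move=> k0; rewrite /c3 /later_below big_nat_cond [RHS]big_nat_cond.
apply: eq_bigl => j; apply: andb_id2l => /andP[kj jm].
by rewrite odd3_letter.
Qed.

(** The first letter is 1; each later one is recovered from its rank in the cyclic order based at
    the letter just before it, which is already known. *)
Lemma c3_inj (n : nat) (s s' : 'S_n.+1) :
  s \in tildeS n.+1 -> s' \in tildeS n.+1 ->
  (forall i, 0 < i <= n -> c3 s i = c3 s' i) -> s = s'.
Proof.
rewrite !inE => /eqP s1 /eqP s'1 eq_c; apply: perm_eq_left_to_right => k ss'.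
case: (posnP k) => [k0|k_gt0].
  by apply/val_inj/succn_inj; rewrite -!letterE k0 s1 s'1.
pose k' : 'I_n.+1 := inord k.-1.
have k'E : (k'.+1 = k)%N by rewrite inordK; have := ltn_ord k; lia.
have k'k : k' < k by rewrite -[X in _ < X]k'E.
have sk : letter s k = (s k').+1 by rewrite -letterE k'E.
have s'k : letter s' k = (s k').+1 by rewrite ss' // -letterE k'E.
have := eq_c k; rewrite k_gt0 -ltnS ltn_ord => /(_ isT).
rewrite !c3_later_below // sk s'k.
apply: (later_below_inj _ _ ss'); first exact: cyc_trans.
  exact: cyc_irr.
(* The letter at [k] differs from the base point, so [cyc_total] applies. *)
have neq (u : 'S_n.+1) : (u k).+1 != (u k').+1.
  rewrite eqSS val_eqE (inj_eq perm_inj) -val_eqE /=.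
  by move: k'k; rewrite neq_ltn => ->; rewrite orbT.
by move=> ?; apply: cyc_total => //; rewrite (ss' k').
Qed.

(** * Descents read off the code *)

(** Each of the [N - a.+1] indices after [a] adds at least 1 to the two sums together if [P a]
    holds, at most 1 otherwise. The index [a] itself adds 1 in the first case only. *)
Lemma first_counted (P Q : pred nat) (a N : nat) : a < N ->
  (forall j, a < j < N -> P a -> P j || Q j) ->
  (forall j, a < j < N -> ~~ P a -> ~~ (P j && Q j)) ->
  P a = (N - a <= \sum_(a <= j < N | P j) 1 + \sum_(a.+1 <= j < N | Q j) 1).
Proof.
move=> aN covered disjoint; rewrite big_ltn_cond //.
have lenE : \sum_(a.+1 <= j < N) 1 = N - a.+1 by rewrite sum_nat_const_nat muln1.
case Pa: (P a); apply/esym.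
  rewrite -addnA -subSS subSn // -lenE add1n ltnS.
  rewrite [X in _ <= X + _]big_mkcond [X in _ <= _ + X]big_mkcond -big_split /=.
  rewrite big_nat_cond [X in _ <= X]big_nat_cond; apply: leq_sum => j.
  by rewrite andbT => /covered/(_ Pa); case: (P j); case: (Q j).
apply/negbTE; rewrite -ltnNge -subnSK // -lenE ltnS.
rewrite [X in X + _ <= _]big_mkcond [X in _ + X <= _]big_mkcond -big_split /=.
rewrite big_nat_cond [X in _ <= X]big_nat_cond; apply: leq_sum => j.
by rewrite andbT => /disjoint/(_ (negbT Pa)); case: (P j); case: (Q j).
Qed.

(** The parity of the position flips between the two codes: one counts letters below a bound, the
    other letters above a bound. These two ranges overlap and cover everything at a descent, and are
    disjoint otherwise. *)
Lemma is_altdescentE (n : nat) (w : 'S_n) (i : nat) : 0 < i < n ->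
  is_altdescent w i = (n - i <= chat w i + chat w i.+1).
Proof.
move=> /andP[i0 iN]; rewrite /is_altdescent /chat -subSS.
have ne j : i.+1 < j < n.+1 -> letter w i.+1 != letter w j.
  by move=> ?; apply/eqP => /letter_inj; lia.
apply: (@first_counted (fun j => alt_inverted i (letter w i) (letter w j))
                      (fun j => alt_inverted i.+1 (letter w i.+1) (letter w j)));
  rewrite ?ltnS // => j /ne; rewrite /alt_inverted /=; case: (odd i) => /=; lia.
Qed.

(** The arcs from letter [i] to letter [i.+1] and on to letter [i.+2] go all the way round when
    letter [i.+2] lies on the first arc, and are disjoint otherwise. *)
Lemma is_3descentE (n : nat) (s : 'S_n.+1) (i : nat) : 0 < i < n ->
  is_3descent s i = (n - i <= c3 s i + c3 s i.+1).
Proof.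
move=> /andP[i0 iN]; rewrite /is_3descent /c3 -subSS -subSS.
apply: (@first_counted
  (fun j => odd3 (letter s i) (letter s i.+1) (letter s j))
  (fun j => odd3 (letter s i.+1) (letter s i.+2) (letter s j)));
  rewrite ?ltnS // => j ij; rewrite !odd3_letter; try lia.
all: have ne1 : letter s i.+1 != letter s j by apply/eqP => /letter_inj; lia.
all: have ne2 : letter s i.+2 != letter s j by apply/eqP => /letter_inj; lia.
all: have ne0 : letter s i != letter s j by apply/eqP => /letter_inj; lia.
all: have ne3 : letter s i != letter s i.+1 by apply/eqP => /letter_inj; lia.
all: have ne4 : letter s i != letter s i.+2 by apply/eqP => /letter_inj; lia.
all: have ne5 : letter s i.+1 != letter s i.+2 by apply/eqP => /letter_inj; lia.
all: rewrite /cyc; lia.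
Qed.

(** * Bounds and cardinalities *)

Lemma count_nat_le (P : pred nat) (a N : nat) :
  \sum_(a <= j < N | P j) 1 <= N - a.
Proof. by rewrite sum1_count (leq_trans (count_size _ _)) // size_iota. Qed.

Lemma chat_le (n : nat) (w : 'S_n) (i : nat) : chat w i <= n - i.
Proof. by rewrite -subSS count_nat_le. Qed.

Lemma c3_le (n : nat) (s : 'S_n.+1) (i : nat) : c3 s i <= n - i.
Proof. by rewrite -subSS -subSS count_nat_le. Qed.

Lemma card_tildeS (n : nat) : #|tildeS n.+1| = n`!.
Proof.
have -> : tildeS n.+1 = [set s | perm_on [set~ ord0] s].
  apply/setP => s; rewrite !inE (letterE s ord0) eqSS -[0]/(val (@ord0 n)).
  rewrite val_eqE; apply/eqP/subsetP => [s0 x|s0].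
    by rewrite !inE; apply: contraNneq => ->; rewrite s0.
  by apply/eqP/negPn/negP => /s0; rewrite !inE eqxx.
by rewrite cardsE card_perm cardsC1 card_ord.
Qed.

(* Codes are indexed from 0 here: the value at [i] stands for c_(i+1). *)
Definition codes (n : nat) : {set {ffun 'I_n -> 'I_n}} :=
  [set f | f \in family (fun i : 'I_n => [pred x : 'I_n | x < n - i])].

Lemma card_codes (n : nat) : #|codes n| = n`!.
Proof.
(* The product of the sizes [n - i] is the falling factorial [n ^_ n]. *)
rewrite cardsE card_family foldrE big_image /= -ffactnn ffact_prod.
apply: eq_bigr => i _; rewrite -sum1_card.
by rewrite -(big_ord_widen n (fun=> 1)) ?leq_subr // sum1_card card_ord.
Qed.

(** * Transfer of both sums to codes *)

(** Under the bound [c i <= n.+1 - i] the default value of [inord] is never reached. *)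
Definition code_ffun (n : nat) (c : nat -> nat) : {ffun 'I_n.+1 -> 'I_n.+1} :=
  [ffun i : 'I_n.+1 => inord (c i.+1)].

Lemma code_ffunE (n : nat) (c : nat -> nat) (i : nat) :
  (forall i, c i <= n.+1 - i) -> i <= n ->
  code_ffun n c (inord i) = c i.+1 :> nat.
Proof.
by move=> c_le i_n; rewrite ffunE inordK inordK //; have := c_le i.+1; lia.
Qed.

(** An injection between finite sets of equal size is onto, so no word has to be rebuilt from its
    code. *)
Lemma sum_code_ffun (V : nmodType) (T : finType) (A : {set T}) (n : nat)
    (c : T -> nat -> nat) (G : {ffun 'I_n.+1 -> 'I_n.+1} -> V) :
  (forall x i, c x i <= n.+1 - i) ->
  {in A &, forall x y, (forall i, 0 < i <= n.+1 -> c x i = c y i) -> x = y} ->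
  #|A| = n.+1`! ->
  (\sum_(x in A) G (code_ffun n (c x)) = \sum_(f in codes n.+1) G f)%R.
Proof.
move=> c_le c_inj cardA.
have code_inj : {in A &, injective (fun x => code_ffun n (c x))}.
  move=> x y Ax Ay eq_xy; apply: c_inj => // -[|i] //= i_n.
  by rewrite -!(@code_ffunE n) // eq_xy.
suff <- : [set code_ffun n (c x) | x in A] = codes n.+1 by rewrite big_imset.
apply/eqP; rewrite eqEcard card_codes card_in_imset // cardA leqnn andbT.
apply/subsetP => _ /imsetP[x Ax ->]; rewrite inE; apply/familyP => i.
by rewrite ffunE inE inordK; have := c_le x i.+1; have := ltn_ord i; lia.
Qed.

(** The last entry of a code is 0, so the exponent of [qvar] is the sum of the whole code. *)
Definition code_weight (n : nat) (f : {ffun 'I_n.+1 -> 'I_n.+1}) :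
    {poly {poly int}} :=
  (tvar ^+ (\sum_(1 <= i < n.+1 |
              (n.+1 - i <= f (inord i.-1) + f (inord i))%N) 1%N)
   * qvar ^+ (\sum_(1 <= i < n.+1) f (inord i.-1)))%R.

Lemma code_weightE (n : nat) (c : nat -> nat) (D : pred nat) :
  (forall i, c i <= n.+1 - i) ->
  (forall i, 0 < i < n.+1 -> D i = (n.+1 - i <= c i + c i.+1)) ->
  code_weight (code_ffun n c) =
  (tvar ^+ (\sum_(1 <= i < n.+1 | D i) 1%N)
   * qvar ^+ (\sum_(1 <= i < n.+1) c i))%R.
Proof.
move=> c_le DE; rewrite /code_weight; congr (_ ^+ _ * _ ^+ _)%R.
  rewrite big_nat_cond [RHS]big_nat_cond; apply: eq_bigl => i.
  apply: andb_id2l => /andP[i0 i_n]; rewrite DE ?i0 //.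
  by rewrite !code_ffunE ?prednK //; lia.
apply: eq_big_nat => i /andP[i0 i_n].
by rewrite code_ffunE ?prednK //; lia.
Qed.

Unset Implicit Arguments.
Local Open Scope ring_scope.

Theorem theorem3p7 (n : nat) (hn : (1 <= n)%N) :
  \sum_(s in tildeS n.+1) tvar ^+ d3 s * qvar ^+ i3 s =
  \sum_(w : 'S_n) tvar ^+ dhat w * qvar ^+ ihat w.
Proof.
case: n hn => // n _.
(* Each summand, on either side, becomes the same function [code_weight] of the code. *)
under eq_bigr => s _ do
  rewrite -(code_weightE (c3_le s) (fun i => is_3descentE s (i := i))).
under [RHS]eq_bigr => w _ do
  rewrite -(code_weightE (chat_le w) (fun i => is_altdescentE w (i := i))).
rewrite (sum_code_ffun _ (fun s => c3_le s) (@c3_inj n.+1) (card_tildeS _)).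
rewrite -(sum_code_ffun (A := [set: 'S_n.+1]) (c := @chat n.+1)).
- by apply: eq_bigl => w; rewrite inE.
- exact: chat_le.
- by move=> w w' _ _; apply: chat_inj.
- by rewrite cardsT card_Sn.
Qed.
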